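(* For every real $\varepsilon>0$, there exists a constant $C_0>0$ (depending only on $\varepsilon$) such that the following holds. Let $H$ be a graph with $h\ge 1$ edges and no isolated vertices, and let $G$ be an $n$-vertex graph with $n\ge C_0h$ and $\delta(G)\ge(1+\varepsilon)n/2$. Then $G$ contains a spanning $H$-subdivision in which the lengths of any two subdivision paths differ by at most one.
   Context: Graphs are finite, simple and undirected; $\delta(G)$ denotes the minimum degree of $G$. The length of a path is its number of edges. Given a graph $H$, an $H$-subdivision is obtained by replacing each edge $uv\in E(H)$ with a path between $u$ and $v$ so that these paths (the subdivision paths) are internally vertex-disjoint and their internal vertices avoid the vertices corresponding to $V(H)$ (the branch vertices). Thus an $H$-subdivision in $G$ consists of distinct branch vertices $b_v\in V(G)$, one for each $v\in V(H)$, and, for each edge $uv\in E(H)$, a path in $G$ between $b_u$ and $b_v$ of length at least one, such that no internal vertex of any of these paths is a branch vertex and no vertex is an internal vertex of two different paths. An $H$-subdivision in $G$ is spanning if it contains every vertex of $G$, i.e. every vertex of $G$ is a branch vertex or an internal vertex of some subdivision path. *)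

(* Defs.v *)
From HB Require Import structures.
From mathcomp Require Import all_boot all_order all_algebra.
From mathcomp Require Import reals.

Set Implicit Arguments.
Unset Strict Implicit.
Unset Printing Implicit Defensive.

Import Order.TTheory GRing.Theory Num.Theory.

Record sgraph := SGraph {
  vertex :> finType;
  adj : rel vertex;
  adj_sym : symmetric adj;
  adj_irrefl : irreflexive adj }.

Definition edges (G : sgraph) : {set {set G}} :=
  [set [set p.1; p.2] | p : G * G & adj p.1 p.2].

Definition degree (G : sgraph) (v : G) : nat := #|[set w | adj v w]|.

(* Degrees are smaller than #|G|, so the default value of the minimum only
   matters for the graph without vertices. *)
Definition min_degree (G : sgraph) : nat :=
  \big[minn/#|G|]_(v : G) degree v.

Definition no_isolated (G : sgraph) : Prop := forall v : G, (0 < degree v)%N.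

(* [is_path x s y]: the vertices x, s_0, ..., s_(k-1), y, in this order, form a
   path of G with ends x, y and internal vertices s; its length is
   [path_length s]. *)
Definition is_path (G : sgraph) (x : G) (s : seq G) (y : G) : bool :=
  path (@adj G) x (rcons s y) && uniq (x :: rcons s y).

Definition path_length (G : sgraph) (s : seq G) : nat := (size s).+1.

(* An edge uv of H is visited as both ordered pairs (u, v) and (v, u); they
   carry the same path of G, traversed in opposite directions. Values of
   [inner] on non-adjacent pairs are irrelevant. *)
Record subdivision (H G : sgraph) := Subdivision {
  branch : H -> G;
  inner : H -> H -> seq G;
  branch_inj : injective branch;
  inner_path : forall u v : H, adj u v ->
    is_path (branch u) (inner u v) (branch v);
  inner_rev : forall u v : H, adj u v -> inner v u = rev (inner u v);
  inner_branch : forall u v w : H, adj u v -> branch w \notin inner u v;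
  inner_disjoint : forall u v u' v' : H, adj u v -> adj u' v' ->
    [set u; v] != [set u'; v'] ->
    forall x : G, ~~ ((x \in inner u v) && (x \in inner u' v')) }.

Definition spanning (H G : sgraph) (S : subdivision H G) : Prop :=
  forall x : G, (exists w : H, x = branch S w) \/
    (exists u v : H, adj u v /\ x \in inner S u v).

Definition balanced (H G : sgraph) (S : subdivision H G) : Prop :=
  forall u v u' v' : H, adj u v -> adj u' v' ->
    (path_length (inner S u v) <= path_length (inner S u' v') + 1)%N.

(* Main.v *)
Require Import Defs.
From HB Require Import structures.
From mathcomp Require Import all_boot all_order all_algebra.
From mathcomp Require Import reals.
From mathcomp Require Import ring lra zify.

Set Implicit Arguments.
Unset Strict Implicit.
Unset Printing Implicit Defensive.

Import Order.TTheory GRing.Theory Num.Theory.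
Local Open Scope ring_scope.

(** The branch vertices can be placed anywhere: H has at most 2h vertices, so
    deleting their images lowers every degree by at most eps n / 4. Let F be the set of the remaining vertices, and k the integer part
    of |F| / h. It then remains to cut F into h blocks of k or k + 1 vertices,
    one for each edge uv of H, and to thread a path from b_u to b_v through all
    the vertices of the block of uv. Inside a block of size f this is possible
    as soon as all its vertices, and b_u and b_v, have at least f/2 + 1
    neighbours in it: this is Dirac's argument with two prescribed ends
    [ham_path].

    The difficulty is that k is only a large constant. A vertex has the right
    degree into a random k-set up to an error of probability depending on k
    alone, so that in a random partition into h blocks, with h possibly linear
    in n, some vertices are expected to fail. The
    blocks are obtained by repeated halving instead: F and the set of edges of
    H are cut into two parts each, a part of the edges being matched with a
    part of the vertices of proportional size, and the parts are cut again
    until only one edge is left in each. At every cut, only the degrees of the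
    vertices and of the path ends of a part into that same part matter. Their
    number is linear in the size f of the part, and a fourth moment bound, which gains a factor f^2
    over the trivial one, suffices to control all of them at once
    [split_exact]. The relative error of a cut at size f is of order f^(-1/4);
    these errors form a geometric series along the halving, dominated by its
    last term, of order k^(-1/4). Hence for k large the degrees stay above
    (1/2 + eps/8) f down to the blocks [routing_exists]. *)

(** * Hamiltonian paths with prescribed ends *)

Section HamiltonPath.
Variables (T : eqType) (e : rel T).
Hypotheses (e_sym : symmetric e) (e_irr : irreflexive e).

(** The number of consecutive pairs of x :: s that are not edges; an ordering
    of the vertices is improved by exchanges until it reaches 0. *)
Fixpoint gaps (x : T) (s : seq T) : nat :=
  if s is y :: s' then (~~ e x y + gaps y s')%N else 0%N.

Lemma gaps_path x s : (gaps x s == 0)%N = path e x s.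
Proof. by elim: s x => //= y s IH x; rewrite addn_eq0 IH eqb0 negbK. Qed.

Lemma gaps_cat x s t : gaps x (s ++ t) = (gaps x s + gaps (last x s) t)%N.
Proof. by elim: s x => //= y s IH x; rewrite IH addnA. Qed.

Lemma gaps_rev x s : gaps (last x s) (rev (belast x s)) = gaps x s.
Proof.
elim: s x => //= y s IH x.
rewrite rev_cons -cats1 gaps_cat IH /= addn0 addnC e_sym.
by case: s {IH} => [|z s] //=; rewrite rev_cons last_rcons.
Qed.

(** Reversing the segment from b to c replaces the consecutive pairs ab and cd
    by ac and bd, and keeps the others because e is symmetric. *)
Lemma two_opt a b m c d r :
  ~~ e a b || ~~ e c d -> e a c -> e b d ->
  (gaps a (rev (b :: rcons m c) ++ d :: r)
     < gaps a (b :: rcons m c ++ d :: r))%N.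
Proof.
move=> gap ac bd.
have -> : rev (b :: rcons m c) = c :: rev (belast b (rcons m c)).
  by rewrite lastI last_rcons rev_rcons.
have := gaps_rev b (rcons m c); rewrite last_rcons => gE.
have lE : last c (rev (belast b (rcons m c))) = b.
  by case: (m) => [|z m'] //=; rewrite rev_cons last_rcons.
rewrite /= !gaps_cat /= gE lE last_rcons ac bd.
by case/orP: gap => ->; case: (e _ _) => /=; lia.
Qed.

(** The exchange at positions i < j of x :: t. The two hypotheses on edges
    exclude j = i + 1, where both pairs would already be edges. *)
Lemma two_opt_at x t i j : (i < j)%N -> (j < size t)%N ->
  let v := nth x (x :: t) in
  ~~ e (v i) (v i.+1) || ~~ e (v j) (v j.+1) ->
  e (v i) (v j) -> e (v i.+1) (v j.+1) ->
  exists t', [/\ perm_eq t' t, last x t' = last x t & (gaps x t' < gaps x t)%N].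
Proof.
move=> ij jt v gap eij eij'.
have {}ij : (i.+1 < j)%N.
  rewrite ltn_neqAle ij andbT; apply/eqP => ij'; move: gap.
  by rewrite -{1}ij' in eij; rewrite -{1}ij' eij eij'.
have lst : last x (take i t) = v i.
  rewrite -nth_last size_take (ltn_trans _ jt) ?(ltn_trans _ ij) // /v.
  case: (i) ij => [|i'] ij /=; rewrite ?take0 // nth_take //;
    apply: set_nth_default; lia.
pose m := take (j - i.+2) (drop i.+1 t); pose r := drop j.+1 t.
have tE : t = take i t ++ v i.+1 :: rcons m (v j) ++ v j.+1 :: r.
  rewrite -[LHS](cat_take_drop i) (drop_nth x); last lia.
  congr (_ ++ _ :: _); rewrite -[LHS](cat_take_drop (j - i.+2)) -/m drop_drop.
  have -> : (j - i.+2 + i.+1)%N = j.-1 by lia.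
  have -> : drop j.-1 t = nth x t j.-1 :: v j.+1 :: r.
    rewrite (drop_nth x); last lia.
    by rewrite prednK ?(drop_nth x jt) //; lia.
  by rewrite -cats1 -catA /= /v; case: (j) ij => // j' _.
exists (take i t ++ rev (v i.+1 :: rcons m (v j)) ++ v j.+1 :: r); split.
- by rewrite {2}tE perm_cat2l -[v i.+1 :: _ ++ _]cat_cons perm_cat2r perm_rev.
- by rewrite [in RHS]tE !last_cat /= last_cat.
rewrite {2}tE !gaps_cat ltn_add2l lst.
by rewrite -gaps_cat; exact: two_opt.
Qed.

Lemma count_nth (P : pred T) x t n : n = size t ->
  #|[set i : 'I_n | P (nth x t i)]| = count P t.
Proof.
move=> ->.
by rewrite -sum1dep_card -sum1_count [RHS](big_nth x) big_mkord.
Qed.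

Lemma gap_position x t : (0 < gaps x t)%N ->
  exists2 i, (i < size t)%N & ~~ e (nth x (x :: t) i) (nth x (x :: t) i.+1).
Proof.
rewrite lt0n gaps_path => /(pathP x) npath.
case: (pickP [pred i : 'I_(size t) | ~~ e (nth x (x :: t) i) (nth x t i)]).
  by move=> i /= gi; exists i.
move=> nogap; case: npath => i it; apply/negPn/negP => gi.
by have := nogap (Ordinal it); rewrite /= gi.
Qed.

(** Dirac's count: let v_g v_(g+1) be a gap. Among the size s + 1 positions j,
    at least size s / 2 + 1 satisfy e v_g v_j, and as many satisfy
    e v_(g+1) v_(j+1); a common j gives an exchange that removes the gap. *)
Lemma fewer_gaps x s y : let t := rcons s y in
  {in x :: t, forall v, (size s + 2 <= 2 * count (e v) s)%N} ->
  (0 < gaps x t)%N ->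
  exists t', [/\ perm_eq t' t, last x t' = last x t & (gaps x t' < gaps x t)%N].
Proof.
move=> t deg /gap_position[g gt gap]; set v := nth x (x :: t) in gap.
have szt : size t = (size s).+1 by rewrite size_rcons.
pose J1 := [set j : 'I_(size t) | e (v g) (nth x (x :: s) j)].
pose J2 := [set j : 'I_(size t) | e (v g.+1) (nth x t j)].
have c1 : (size s + 2 <= 2 * #|J1|)%N.
  rewrite (count_nth _ x (t := x :: s)) //.
  apply: leq_trans (deg (v g) _) _; first by rewrite mem_nth // ltnW.
  by rewrite leq_mul2l /= leq_addl.
have c2 : (size s + 2 <= 2 * #|J2|)%N.
  rewrite count_nth //; apply: leq_trans (deg (v g.+1) _) _; first by rewrite mem_nth.
  by rewrite leq_mul2l /= /t -cats1 count_cat leq_addr.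
have [j] : exists j, j \in J1 :&: J2.
  apply/set0Pn; rewrite -card_gt0.
  have : (#|J1 :|: J2| <= (size s).+1)%N.
    by rewrite (leq_trans (max_card _)) // card_ord szt.
  rewrite cardsU => cU.
  by move: c1 c2 cU; lia.
rewrite !inE => /andP[j1 j2].
have {}j1 : e (v g) (v j).
  have jl : (j < size (x :: s))%N by rewrite /= -szt.
  by rewrite {2}/v /t -rcons_cons nth_rcons jl.
have {j2} : e (v g.+1) (v j.+1) by [].
(* The exchange is performed at the smaller of the two positions; for j < g the
   gap is the second of the two replaced pairs. *)
case: (ltngtP g j) => [gj|jg|gj] j2.
- by apply: (two_opt_at gj) => //; rewrite -/v gap.
- by apply: (two_opt_at jg) => //; rewrite -/v ?gap ?orbT // e_sym.
by rewrite gj e_irr in j1.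
Qed.

Lemma ham_path x s y :
  {in x :: rcons s y, forall v, (size s + 2 <= 2 * count (e v) s)%N} ->
  exists2 s', perm_eq s' s & path e x (rcons s' y).
Proof.
have [n] := ubnP (gaps x (rcons s y)); elim: n => // n IH in s * => gn deg.
have [g0|] := posnP (gaps x (rcons s y)).
  by exists s => //; rewrite -gaps_path g0.
move=> /(fewer_gaps deg)[t [pt lt gt]].
case/lastP: t => [|s' y'] in pt lt gt *.
  by move/perm_size: pt; rewrite size_rcons.
rewrite !last_rcons in lt; rewrite {}lt in pt gt.
have {}pt : perm_eq s' s.
  by move: pt; rewrite perm_rcons perm_sym perm_rcons perm_cons perm_sym.
have [||s'' p1 p2] := IH s'; first by lia.
  move=> v vs; rewrite (perm_size pt) (permP pt) deg //.
  by move: vs; rewrite !inE !mem_rcons !inE (perm_mem pt).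
by exists s'' => //; rewrite (perm_trans p1).
Qed.
End HamiltonPath.

(** * Splitting a set evenly with respect to a family of subsets *)

Section Splitting.
Variable R : realFieldType.

(** An upper bound for the expectation of (c + Y)^4, where Y is a sum of s
    independent centred indicator variables. It serves as a potential in place
    of the expectation itself. *)
Definition moment4_bound (c s : R) : R := c ^+ 4 + 2 * s * c ^+ 2 + s ^+ 2.

(** Revealing one indicator, which is 1 with probability p, does not increase
    the potential on average. *)
Lemma moment4_bound_step (p c s : R) : 0 <= p <= 1 -> 0 <= s ->
  p * moment4_bound (c + (1 - p)) s + (1 - p) * moment4_bound (c - p) s
    <= moment4_bound c (s + 1).
Proof.
move=> /andP[p0 p1] s0; rewrite /moment4_bound.
set v := p * (1 - p).
have v0 : 0 <= v by rewrite mulr_ge0 // subr_ge0.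
have v4 : v <= 1 / 4.
  by have := sqr_ge0 (p - 1 / 2); rewrite /v; nra.
(* v and d are the variance and the third central moment of the indicator. *)
pose d := v * (1 - 2 * p).
have d2 : d ^+ 2 <= 1 / 16.
  have -> : d ^+ 2 = v ^+ 2 * (1 - 4 * v) by rewrite /d /v; ring.
  have : v ^+ 2 <= 1 / 16 by nra.
  have : 0 <= v ^+ 2 by exact: sqr_ge0.
  nra.
(* Completing the square in c absorbs the linear term 4cd, whose sign is
   unknown. *)
rewrite -subr_ge0.
have -> : c ^+ 4 + 2 * (s + 1) * c ^+ 2 + (s + 1) ^+ 2 -
   (p * ((c + (1 - p)) ^+ 4 + 2 * s * (c + (1 - p)) ^+ 2 + s ^+ 2) +
    (1 - p) * ((c - p) ^+ 4 + 2 * s * (c - p) ^+ 2 + s ^+ 2)) =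
   2 * (s * (1 - v)) + 6 * (c ^+ 2 * (1 / 4 - v)) + (c - 4 * d) ^+ 2 / 2
     + (1 - v - 8 * d ^+ 2) + 3 * v ^+ 2.
  by rewrite /d /v; field.
have h1 : 0 <= s * (1 - v) by rewrite mulr_ge0 //; lra.
have h2 : 0 <= c ^+ 2 * (1 / 4 - v) by rewrite mulr_ge0 ?sqr_ge0 //; lra.
have h3 : 0 <= (c - 4 * d) ^+ 2 by exact: sqr_ge0.
have h4 : 0 <= v ^+ 2 by exact: sqr_ge0.
lra.
Qed.

(** A random subset of F of density p, derandomised by conditional
    expectations: the elements of F are treated one by one, and each is put in
    A or left out so that the total potential does not increase. The offset c S
    records the deviation accumulated so far on S. *)
Lemma split_moment (T : finType) (Ss : seq {set T}) (p : R) (F : {set T})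
    (c : {set T} -> R) : 0 <= p <= 1 ->
  exists2 A : {set T}, A \subset F &
    \sum_(S <- Ss) (c S + (#|S :&: A|%:R - p * #|S :&: F|%:R)) ^+ 4
      <= \sum_(S <- Ss) moment4_bound (c S) #|S :&: F|%:R.
Proof.
move=> p01; have [n] := ubnP #|F|; elim: n => // n IH in F c *.
have [-> _ | [x xF]] := set_0Vmem F.
  exists set0 => //; apply: ler_sum => S _.
  by rewrite setI0 cards0 /moment4_bound; rewrite !(mulr0, subrr, addr0, mul0r, expr0n).
rewrite (cardsD1 x) xF ltnS add1n => /IH{}IH.
have FE S : #|S :&: F| = ((x \in S) + #|S :&: (F :\ x)|)%N.
  rewrite (cardsD1 x) inE xF andbT; congr (_ + _)%N; apply: eq_card => y.
  by rewrite !inE andbCA.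
(* The offsets after putting x in A, and after leaving it out. *)
pose cin S := c S + (x \in S)%:R * (1 - p).
pose cout S := c S - (x \in S)%:R * p.
pose Z (d : {set T} -> R) := \sum_(S <- Ss) moment4_bound (d S) #|S :&: (F :\ x)|%:R.
have avg : p * Z cin + (1 - p) * Z cout
    <= \sum_(S <- Ss) moment4_bound (c S) #|S :&: F|%:R.
  rewrite !mulr_sumr -big_split /=; apply: ler_sum => S _.
  rewrite FE /cin /cout; case: (x \in S); last first.
    by rewrite !mul0r subr0 addr0 add0n -mulrDl subrKC mul1r.
  by rewrite !mul1r addnC natrD moment4_bound_step.
have pick : Z cin <= \sum_(S <- Ss) moment4_bound (c S) #|S :&: F|%:R \/
            Z cout <= \sum_(S <- Ss) moment4_bound (c S) #|S :&: F|%:R.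
  case: leP => [|lt1]; first by left.
  case: leP => [|lt2]; first by right.
  by case/andP: p01 => p0 p1; have [|] := lerP (Z cin) (Z cout); nra.
case: pick => le.
- have [A AF leA] := IH cin; exists (x |: A).
    by rewrite subUset sub1set xF (subset_trans AF) ?subsetDl.
  apply: le_trans le; apply: le_trans leA; apply: ler_sum => S _.
  have xA : x \notin A by apply/negP => /(subsetP AF); rewrite !inE eqxx.
  rewrite FE (cardsD1 x (S :&: _)) !inE eqxx andbT.
  have -> : S :&: (x |: A) :\ x = S :&: A.
    apply/setP => y; rewrite !inE; case: eqP => [->|] //=.
    by rewrite (negPf xA) andbF.
  rewrite /cin !natrD le_eqVlt; apply/orP; left; apply/eqP.
  by congr (_ ^+ 4); ring.
have [A AF leA] := IH cout; exists A.
  by rewrite (subset_trans AF) ?subsetDl.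
apply: le_trans le; apply: le_trans leA; apply: ler_sum => S _.
rewrite FE /cout !natrD le_eqVlt; apply/orP; left; apply/eqP.
by congr (_ ^+ 4); ring.
Qed.

Lemma set_between (T : finType) (A F : {set T}) f : A \subset F ->
  (#|A| <= f <= #|F|)%N -> exists B : {set T}, [/\ A \subset B, B \subset F & #|B| = f].
Proof.
move=> AF /andP[Af fF].
pose D := [set x in take (f - #|A|) (enum (F :\: A))].
have DF x : x \in D -> x \in F :\: A by rewrite inE => /mem_take; rewrite mem_enum.
exists (A :|: D); split; first exact: subsetUl.
  by rewrite subUset AF; apply/subsetP => x /DF /setDP[].
rewrite cardsU (_ : A :&: D = set0) ?cards0 ?subn0; last first.
  by apply/setP => x; rewrite in_set0 !inE; apply/negP => /andP[xA /mem_take];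
     rewrite mem_enum inE xA.
rewrite cardsE (card_uniqP _) ?take_uniq ?enum_uniq // size_take -cardE.
rewrite cardsD (setIidPr AF).
by case: ltnP; lia.
Qed.

Lemma ler_norm_expr4 (x y : R) : 0 <= y -> x ^+ 4 <= y ^+ 4 -> `|x| <= y.
Proof.
move=> y0 le; rewrite -(@ler_pXn2r _ 4) ?nnegrE //.
by rewrite -normrX ger0_norm // exprn_even_ge0.
Qed.

(** Every single deviation is at most the fourth root of the sum of fourth
    powers bounded in [split_moment]. Adding F itself to the family controls the
    size of the random subset up to X; correcting the size to f then changes
    each intersection by at most X more. *)
Lemma split_exact (T : finType) (Ss : seq {set T}) (F : {set T}) (f : nat) (X : R) :
  (forall S, S \in Ss -> S \subset F) -> (0 < #|F|)%N -> (f <= #|F|)%N -> 0 <= X ->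
  (size Ss).+1%:R * #|F|%:R ^+ 2 <= X ^+ 4 ->
  exists A : {set T}, [/\ A \subset F, #|A| = f &
    (forall S, S \in Ss -> `|#|S :&: A|%:R - f%:R / #|F|%:R * #|S|%:R| <= 2 * X)].
Proof.
move=> SF F0 fF X0 bnd; set p := f%:R / #|F|%:R.
have F0' : 0 < #|F|%:R :> R by rewrite ltr0n.
have p01 : 0 <= p <= 1 by rewrite divr_ge0 //= ler_pdivrMr // mul1r ler_nat.
have [A AF leA] := split_moment (F :: Ss) F (fun=> 0) p01.
have dev S : S \in F :: Ss -> `|#|S :&: A|%:R - p * #|S|%:R| <= X.
  move=> SFs; have SF' : S \subset F by move: SFs; rewrite inE => /predU1P[->|/SF].
  apply: ler_norm_expr4 => //.
  apply: le_trans bnd; apply: le_trans (_ : \sum_(S <- F :: Ss) #|F|%:R ^+ 2 <= _).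
    apply: le_trans (le_trans leA _).
      rewrite (big_rem S) //= add0r (setIidPl SF') lerDl.
      by apply: sumr_ge0 => S' _; rewrite exprn_even_ge0.
    rewrite !big_seq; apply: ler_sum => S' S'F; rewrite /moment4_bound.
    rewrite !expr0n /= mulr0 !add0r ler_pXn2r ?nnegrE // ler_nat.
    by rewrite subset_leq_card // subsetIr.
  by rewrite big_const_seq count_predT iter_addr_0 [leRHS]mulr_natl.
have devF : `|#|A|%:R - f%:R| <= X.
  have := dev F (mem_head _ _); rewrite (setIidPr AF) /p.
  by rewrite divfK // gt_eqF.
have [B [BF Bf AB]] : exists B : {set T}, [/\ B \subset F, #|B| = f &
    (A \subset B) || (B \subset A)].
  case: (leqP f #|A|) => le.
    have [|B [_ BA Bf]] := @set_between _ set0 A f (sub0set _); first by rewrite cards0.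
    by exists B; rewrite (subset_trans BA AF) BA orbT.
  have [|B [AB BF Bf]] := @set_between _ A F f AF; first by rewrite ltnW.
  by exists B; rewrite BF AB.
exists B; split=> // S SSs.
have chg : `|#|S :&: B|%:R - #|S :&: A|%:R| <= `|#|A|%:R - f%:R| :> R.
  have aux (C D : {set T}) : C \subset D ->
      0 <= (#|S :&: D|%:R - #|S :&: C|%:R : R) <= #|D|%:R - #|C|%:R.
    move=> CD; rewrite subr_ge0 ler_nat subset_leq_card ?setIS //=.
    rewrite lerBlDr addrAC lerBrDr -!natrD ler_nat.
    rewrite -(cardsID S D) -(cardsID S C) ![_ :&: S]setIC -[leqRHS]addnA leq_add2l.
    by rewrite [leqRHS]addnC leq_add2l (subset_leq_card (setSD S CD)).
  rewrite -Bf; case/orP: AB => /aux/andP[h1 h2].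
    by rewrite [X in _ <= X]distrC !ger0_norm // (le_trans h1 h2).
  by rewrite distrC !ger0_norm // (le_trans h1 h2).
have := dev S; rewrite inE SSs orbT => /(_ isT) devS.
rewrite (_ : _ - _ = (#|S :&: B|%:R - #|S :&: A|%:R)
                     + (#|S :&: A|%:R - p * #|S|%:R)); last by ring.
apply: le_trans (ler_normD _ _) _.
by rewrite mulr_natl mulr2n lerD // (le_trans chg).
Qed.
End Splitting.

(** * Routing the edges by repeated halving *)

Section Routing.
Variables (R : realFieldType) (G : sgraph) (E : finType) (src tgt : E -> G).
Variables (eps : R) (k : nat).
Hypothesis eps_gt0 : 0 < eps.
Implicit Types (I : {set E}) (F : {set G}).

Definition nbrs (v : G) : {set G} := [set w | adj v w].

(** The vertices whose degree into F has to be controlled: those of F and the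
    ends of the paths, which may be shared with other parts. *)
Definition touched (I : {set E}) (F : {set G}) : {set G} :=
  F :|: (src @: I :|: tgt @: I).

(** The density above 1/2 kept by a part with about 2^j paths. Increments in
    (7/8)^j have a finite sum, and decrease more slowly than the errors
    2^(-j/4), because (7/8)^4 > 1/2. *)
Definition slack j : R := eps / 8 * (2 - (7 / 8) ^+ j).

Definition rich (a : R) (I : {set E}) (F : {set G}) :=
  forall v, v \in touched I F -> (1 / 2 + a) * #|F|%:R <= #|nbrs v :&: F|%:R.

Definition routing (I : {set E}) (F : {set G}) (inn : E -> seq G) :=
  [/\ forall d, d \in I -> is_path (src d) (inn d) (tgt d),
      forall d, d \in I -> (k <= size (inn d) <= k.+1)%N,
      forall d x, d \in I -> x \in inn d -> x \in F,
      forall x, x \in F -> exists2 d, d \in I & x \in inn d &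
      forall d d' x, d \in I -> d' \in I -> x \in inn d -> x \in inn d' -> d = d'].

Lemma routing_setU (I1 I2 : {set E}) (F1 F2 : {set G}) inn1 inn2 :
  [disjoint I1 & I2] -> [disjoint F1 & F2] ->
  routing I1 F1 inn1 -> routing I2 F2 inn2 ->
  routing (I1 :|: I2) (F1 :|: F2) (fun d => if d \in I1 then inn1 d else inn2 d).
Proof.
move=> dI dF [p1 s1 f1 c1 u1] [p2 s2 f2 c2 u2].
have in2 d : d \in I1 :|: I2 -> (d \in I1) = false -> d \in I2.
  by rewrite inE => /orP[->|].
split=> [d dI'|d dI'|d x dI'|x|d d' x dI' dI''].
- by case: ifPn => [/p1|/negPf/(in2 d dI')/p2].
- by case: ifPn => [/s1|/negPf/(in2 d dI')/s2].
- by rewrite inE; case: ifPn => [/f1 h /h ->//|/negPf/(in2 d dI')/f2 h /h ->]; rewrite orbT.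
- rewrite inE => /orP[/c1|/c2] [d dI' xd]; exists d; rewrite ?inE ?dI' ?orbT //.
  by rewrite (disjointFl dI dI').
have nF x1 : x1 \in F1 -> x1 \in F2 -> d = d'.
  by move=> h; rewrite (disjointFr dF h).
case: ifPn => [h|/negPf/(in2 d dI') h]; case: ifPn => [h'|/negPf/(in2 d' dI'') h'] xd xd'.
- exact: u1 xd xd'.
- by apply: nF (f1 _ _ h xd) (f2 _ _ h' xd').
- by apply: nF (f1 _ _ h' xd') (f2 _ _ h xd).
exact: u2 xd xd'.
Qed.

Definition feasible (I : {set E}) (F : {set G}) :=
  [/\ (k * #|I| <= #|F| <= k.+1 * #|I|)%N,
      forall d, d \in I -> src d \notin F,
      forall d, d \in I -> tgt d \notin F &
      forall d, d \in I -> src d != tgt d].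

(** When one path is left, it has to pass through all of F; the hypothesis on k
    makes the surplus eps/8 * |F| over half the degree at least one vertex. *)
Lemma routing_edge I F : #|I| = 1%N -> feasible I F -> 8 <= eps * k%:R ->
  rich (eps / 8) I F -> exists inn, routing I F inn.
Proof.
move=> /eqP/cards1P[d ->] [/andP[kF Fk] sF tF st] k8 rF.
have dd : d \in [set d] by rewrite inE.
rewrite cards1 !muln1 in kF Fk.
have deg v : v \in src d :: rcons (enum F) (tgt d) ->
    (size (enum F) + 2 <= 2 * count (adj v) (enum F))%N.
  move=> vs; have {}vs : v \in touched [set d] F.
    rewrite /touched !imset_set1 !inE; move: vs.
    by rewrite !inE mem_rcons !inE mem_enum => /or3P[] ->; rewrite ?orbT.
  have := rF _ vs; have -> : count (adj v) (enum F) = #|nbrs v :&: F|.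
    rewrite -size_filter cardE; congr size; rewrite -[LHS]filter_predI.
    by apply: eq_filter => w; rewrite /= !inE.
  rewrite -cardE -(ler_nat R) natrD natrM => h.
  have : eps * k%:R <= eps * #|F|%:R by rewrite ler_pM2l // ler_nat.
  by lra.
have [s' ps ss] := ham_path (@adj_sym G) (@adj_irrefl G) deg.
have sF' x : (x \in s') = (x \in F) by rewrite (perm_mem ps) mem_enum.
exists (fun=> s'); split.
- move=> _ /set1P->; rewrite /is_path ss /= mem_rcons inE negb_or sF' sF // st //=.
  by rewrite rcons_uniq sF' tF // (perm_uniq ps) enum_uniq.
- by move=> _ _; rewrite (perm_size ps) -cardE kF Fk.
- by move=> _ x _; rewrite sF'.
- by move=> x xF; exists d; rewrite ?sF'.
by move=> d1 d2 x /set1P-> /set1P->.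
Qed.

Lemma slack_step j : slack j.+1 - slack j = eps / 64 * (7 / 8) ^+ j.
Proof. by rewrite /slack exprS; field. Qed.

(** The increment at level j is at least of the order of the fourth root of
    2^(-j), which is the size of the splitting error. *)
Lemma slack_decay j : (eps / 64) ^+ 4 <= (slack j.+1 - slack j) ^+ 4 * 2 ^+ j.
Proof.
rewrite slack_step (exprMn 4 (eps / 64)) -exprM -mulrA ler_peMr ?exprn_even_ge0 //.
rewrite mulnC exprM -exprMn exprn_ege1 //.
by lra.
Qed.

Lemma slack_lb j : eps / 8 <= slack j.
Proof.
have q1 : (7 / 8 : R) ^+ j <= 1 by rewrite exprn_ile1 //; lra.
rewrite /slack; move: (_ ^+ j) q1 => q q1.
by rewrite ler_peMr ?divr_ge0 ?(ltW eps_gt0) //; lra.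
Qed.

Lemma slack_ub j : slack j <= eps / 4.
Proof.
have q0 : 0 <= (7 / 8 : R) ^+ j by rewrite exprn_ge0 //; lra.
rewrite /slack; move: (_ ^+ j) q0 => q q0.
have -> : eps / 4 = eps / 8 * 2 by field.
by rewrite ler_wpM2l ?divr_ge0 ?(ltW eps_gt0) //; lra.
Qed.

Lemma card_touched I F : (#|touched I F| <= #|F| + 2 * #|I|)%N.
Proof.
have [hF _] := leq_card_setU F (src @: I :|: tgt @: I).
have [hI _] := leq_card_setU (src @: I) (tgt @: I).
apply: leq_trans hF _; rewrite leq_add2l (leq_trans hI) // mul2n -addnn.
by rewrite leq_add ?leq_imset_card.
Qed.

Lemma touchedS I I' F F' : I' \subset I -> F' \subset F ->
  touched I' F' \subset touched I F.
Proof. by move=> sI sF; rewrite setUSS // setUSS // imsetS. Qed.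

(** The paths are halved; the surplus |F| - k|I| of the vertices counts the
    paths that get k + 1 of them, and is given to the first half as long as it
    can take it. *)
Lemma feasible_split I F : feasible I F -> (1 < #|I|)%N ->
  exists I1 f1, [/\ I1 \subset I, #|I1| = (#|I|)./2, (f1 <= #|F|)%N,
   (k * #|I1| <= f1 <= k.+1 * #|I1|)%N &
   (k * (#|I| - #|I1|) <= #|F| - f1 <= k.+1 * (#|I| - #|I1|))%N].
Proof.
move=> [/andP[kF Fk] _ _ _] I1.
have [|I' [_ I'I I'c]] := @set_between _ set0 I (#|I|./2) (sub0set _).
  by rewrite cards0 /=; lia.
exists I', (k * #|I'| + minn (#|F| - k * #|I|) #|I'|)%N; rewrite I'c.
have h : (#|I| = #|I|./2 + (#|I| - #|I|./2))%N by lia.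
have kh : (k * #|I| = k * #|I|./2 + k * (#|I| - #|I|./2))%N by rewrite {1}h mulnDr.
rewrite !mulSn in Fk *.
by split=> //; lia.
Qed.

Lemma half_share n : (1 < n)%N -> (n <= 3 * n./2)%N /\ (n <= 3 * (n - n./2))%N.
Proof. lia. Qed.

(** Halving preserves the position of the number of paths between two powers of
    two because 2 ^ j is even for j > 0. *)
Lemma half_dyadic n j : (1 < n)%N -> (n <= 2 ^ j.+1 <= 2 * n)%N ->
  (n./2 <= 2 ^ j <= 2 * n./2)%N /\ (n - n./2 <= 2 ^ j <= 2 * (n - n./2))%N.
Proof. by move=> n1; rewrite expnS; case: j => [|j]; rewrite ?expnS; lia. Qed.

Lemma part_share (i i' f f' : nat) : (0 < k)%N -> (i <= 3 * i')%N ->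
  (f <= k.+1 * i)%N -> (k * i' <= f')%N -> (f <= 6 * f')%N.
Proof.
move=> k0 ii' fi if'; apply: leq_trans fi _.
apply: leq_trans (_ : (2 * k * (3 * i') <= _)%N); first by rewrite leq_mul //; lia.
by rewrite mulnACA leq_mul2l.
Qed.

(** The error of a cut is relative to the whole part, of size f; a subpart has
    at least a sixth of that size, so it is covered by the drop from a' to
    a. *)
Lemma density_kept (a a' f f' P N : R) : a <= a' -> f <= 6 * f' ->
  (1 / 2 + a') * f' <= P -> P - N <= (a' - a) / 6 * f -> (1 / 2 + a) * f' <= N.
Proof.
rewrite -subr_ge0 => aa ff fP PN; have := ler_wpM2l aa ff.
by lra.
Qed.

(** Induction on the level j of the halving. The second lower bound on k says
    that a cut is accurate enough at the last level; by [slack_decay] it then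
    is at every level. *)
Lemma routing_exists j I F : (#|I| <= 2 ^ j <= 2 * #|I|)%N -> feasible I F ->
  8 <= eps * k%:R -> 4 * 12 ^+ 4 <= (eps / 64) ^+ 4 * k%:R ->
  rich (slack j) I F -> exists inn, routing I F inn.
Proof.
move=> Ij fIF k8 kbig; elim: j => [|j IH] in I F Ij fIF *.
  rewrite expn0 in Ij; move=> rF.
  apply: routing_edge => //; first by lia.
  by move=> v vt; apply: le_trans (rF v vt); rewrite ler_wpM2r // lerD2l slack_lb.
move=> rF; have [I1|I1] := eqVneq #|I| 1%N.
  apply: routing_edge => // v vt.
  by apply: le_trans (rF v vt); rewrite ler_wpM2r // lerD2l slack_lb.
have {}I1 : (1 < #|I|)%N by case/andP: Ij; rewrite expnS; lia.
have [A [f1 [AI cA fF kf1 kf2]]] := feasible_split fIF I1.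
have [/andP[kF Fk] sF tF st] := fIF.
have k1 : (0 < k)%N by case: (posnP k) k8 => // ->; lra.
pose d := slack j.+1 - slack j.
have d0 : 0 < d by rewrite /d slack_step mulr_gt0 ?divr_gt0 // exprn_gt0 //; lra.
have F0 : (0 < #|F|)%N by apply: leq_trans kF; rewrite muln_gt0 k1 ltnW.
have F0' : 0 < #|F|%:R :> R by rewrite ltr0n.
(* Deviations of 2X = d|F|/6 are affordable by [density_kept]. *)
pose X := d * #|F|%:R / 12.
have X0 : 0 <= X by rewrite /X divr_ge0 // mulr_ge0 // ltW.
have kj : (k * 2 ^ j <= #|F|)%N.
  apply: leq_trans kF; rewrite leq_mul2l.
  by move: Ij => /andP[_]; rewrite expnS leq_mul2l /= => ->; rewrite orbT.
have dF : 4 * 12 ^+ 4 <= d ^+ 4 * #|F|%:R.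
  apply: le_trans kbig _; apply: le_trans (_ : d ^+ 4 * (2 ^+ j * k%:R) <= _).
    by rewrite mulrA ler_wpM2r // slack_decay.
  rewrite ler_wpM2l ?exprn_even_ge0 // mulrC.
  by rewrite -natrX -natrM ler_nat.
pose Ss := [seq nbrs v :&: F | v <- enum (touched I F)].
have [||B [BF cB devB]] := @split_exact R _ Ss F f1 X _ F0 fF X0.
- by move=> S /mapP[v _ ->]; apply: subsetIr.
- rewrite size_map -cardE.
  apply: le_trans (_ : (4 * #|F|)%:R * #|F|%:R ^+ 2 <= _).
    rewrite ler_wpM2r ?exprn_ge0 // ler_nat.
    apply: leq_ltn_trans (card_touched I F) _.
    have : (#|I| <= #|F|)%N by apply: leq_trans kF; rewrite leq_pmull.
    by move: F0; clear; lia.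
  rewrite natrM /X.
  have -> : (d * #|F|%:R / 12) ^+ 4
     = (d ^+ 4 * #|F|%:R) * (#|F|%:R ^+ 3 / 12 ^+ 4) by field.
  apply: le_trans (ler_wpM2r _ dF); last by rewrite divr_ge0 ?exprn_ge0.
  by rewrite le_eqVlt; apply/orP; left; apply/eqP; field.
have dev v : v \in touched I F -> `|#|nbrs v :&: B|%:R
     - f1%:R / #|F|%:R * #|nbrs v :&: F|%:R| <= d / 6 * #|F|%:R.
  move=> vt; have := devB (nbrs v :&: F); rewrite -setIA (setIidPr BF).
  rewrite (_ : d / 6 * #|F|%:R = 2 * X); last by rewrite /X; field.
  by apply; apply/mapP; exists v; rewrite ?mem_enum.
have F16 : #|F|%:R <= 6 * f1%:R :> R.
  rewrite -natrM ler_nat; case/andP: kf1 => kf1 _.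
  by apply: part_share k1 _ Fk kf1; rewrite cA; case: (half_share I1).
have F26 : #|F|%:R <= 6 * (#|F|%:R - f1%:R) :> R.
  rewrite -natrB // -natrM ler_nat; case/andP: kf2 => kf2 _.
  by apply: part_share k1 _ Fk kf2; rewrite cA; case: (half_share I1).
have cAI : #|I :\: A| = (#|I| - #|A|)%N by rewrite cardsD (setIidPr AI).
have cBF : #|F :\: B| = (#|F| - f1)%N by rewrite cardsD (setIidPr BF) cB.
have low v : v \in touched I F ->
    (1 / 2 + slack j.+1) * f1%:R
      <= f1%:R / #|F|%:R * #|nbrs v :&: F|%:R.
  move=> vt; rewrite mulrC -mulrA ler_wpM2l //.
  by rewrite ler_pdivlMl // mulrC rF.
have [inn1 r1] : exists inn, routing A B inn.
  apply: IH => //.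
  - by rewrite cA; case: (half_dyadic I1 Ij).
  - split; first by rewrite cB.
    + by move=> e eA; apply: contra (sF e (subsetP AI e eA)); apply: (subsetP BF).
    + by move=> e eA; apply: contra (tF e (subsetP AI e eA)); apply: (subsetP BF).
    by move=> e /(subsetP AI)/st.
  move=> v /(subsetP (touchedS AI BF)) vt; rewrite cB.
  apply: (density_kept (f := #|F|%:R) _ F16 (low v vt)); first by rewrite -subr_ge0 ltW.
  by rewrite (le_trans _ (dev v vt)) // distrC ler_norm.
have [inn2 r2] : exists inn, routing (I :\: A) (F :\: B) inn.
  apply: IH => //.
  - by rewrite cAI cA; case: (half_dyadic I1 Ij).
  - split; first by rewrite cBF cAI.
    + by move=> e /setDP[/sF h _]; rewrite inE (negPf h) andbF.
    + by move=> e /setDP[/tF h _]; rewrite inE (negPf h) andbF.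
    by move=> e /setDP[/st].
  move=> v /(subsetP (touchedS (subsetDl I A) (subsetDl F B))) vt.
  rewrite cBF natrB //.
  apply: (density_kept (a' := slack j.+1) (f := #|F|%:R) _ F26 (P := #|nbrs v :&: F|%:R
      - f1%:R / #|F|%:R * #|nbrs v :&: F|%:R)); first by rewrite -subr_ge0 ltW.
    have -> : (1 / 2 + slack j.+1) * (#|F|%:R - f1%:R)
       = ((1 / 2 + slack j.+1) * #|F|%:R) * (1 - f1%:R / #|F|%:R).
      by field; rewrite gt_eqF.
    rewrite -[X in _ <= X - _]mulr1 (mulrC (_ / _)) -mulrBr ler_wpM2r ?rF //.
    by rewrite subr_ge0 ler_pdivrMr // mul1r ler_nat.
  apply: le_trans (le_trans (ler_norm _) (dev v vt)).
  rewrite setIDA cardsD -setIA (setIidPr BF) natrB ?subset_leq_card ?setIS //.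
  by rewrite le_eqVlt; apply/orP; left; apply/eqP; ring.
have dAI : [disjoint A & I :\: A] by rewrite -setI_eq0 setIDA setDIl setDv set0I.
have dBF : [disjoint B & F :\: B] by rewrite -setI_eq0 setIDA setDIl setDv set0I.
exists (fun e => if e \in A then inn1 e else inn2 e).
rewrite -(setID I A) -(setID F B) (setIidPr AI) (setIidPr BF).
exact: routing_setU.
Qed.
End Routing.

(** * From a routing to a subdivision *)

(** Each edge of H with one of its two orientations. *)
Definition arcs (H : sgraph) : {set H * H} :=
  [set p | adj p.1 p.2 && (enum_rank p.1 < enum_rank p.2)%N].

Lemma arcs_rev (H : sgraph) (u v : H) : adj u v ->
  ((v, u) \in arcs H) = ((u, v) \notin arcs H).
Proof.
move=> uv; rewrite !inE /= [adj v u]adj_sym uv /= -leqNgt ltn_neqAle.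
case: eqP => // /ord_inj/enum_rank_inj vu.
by rewrite vu adj_irrefl in uv.
Qed.

Lemma card_arcs (H : sgraph) : #|arcs H| = #|edges H|.
Proof.
have -> : edges H = [set [set p.1; p.2] | p in arcs H].
  apply/setP => X; apply/imsetP/imsetP => [[[u v]]|[p]]; last first.
    by rewrite inE => /andP[pa _] ->; exists p; rewrite ?inE.
  rewrite inE /= => uv ->.
  have [uvA|vuA] := boolP ((u, v) \in arcs H); first by exists (u, v).
  by exists (v, u); [rewrite arcs_rev | rewrite setUC].
rewrite card_in_imset // => -[u v] [u' v']; rewrite !inE /=.
move=> /andP[_ uv] /andP[_ uv'] /setP eqS.
have := eqS u; have := eqS v; rewrite !inE !eqxx ?orbT /=.
move=> /esym/orP[]/eqP vE /esym/orP[]/eqP uE; subst u v => //.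
- by rewrite ltnn in uv.
- by move: (ltn_trans uv uv'); rewrite ltnn.
by rewrite ltnn in uv.
Qed.

Lemma card_no_isolated (H : sgraph) : no_isolated H -> (#|H| <= 2 * #|edges H|)%N.
Proof.
move=> niH; rewrite -card_arcs mul2n -addnn.
apply: leq_trans (_ : #|[set p.1 | p in arcs H] :|: [set p.2 | p in arcs H]| <= _)%N.
  apply: subset_leq_card; apply/subsetP => u _.
  have /card_gt0P[v] := niH u; rewrite inE => uv.
  rewrite inE; apply/orP; have [uvA|vuA] := boolP ((u, v) \in arcs H).
    by left; apply/imsetP; exists (u, v).
  by right; apply/imsetP; exists (v, u); first by rewrite arcs_rev.
have [le _] := leq_card_setU [set p.1 | p in arcs H] [set p.2 | p in arcs H].
by apply: leq_trans le _; rewrite leq_add ?leq_imset_card.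
Qed.

Lemma min_degree_le (G : sgraph) (v : G) : (min_degree G <= degree v)%N.
Proof.
rewrite /min_degree; have := mem_index_enum v.
elim: (index_enum _) => //= w s IH; rewrite inE big_cons geq_min.
by case/predU1P => [->|/IH ->]; rewrite ?leqnn ?orbT.
Qed.

Lemma inj_of_card (S T : finType) : (#|S| <= #|T|)%N -> exists f : S -> T, injective f.
Proof.
move=> le; exists (fun x => enum_val (widen_ord le (enum_rank x))) => x y.
move=> /enum_val_inj/(congr1 val)/= /ord_inj; exact: enum_rank_inj.
Qed.

Lemma is_path_rev (G : sgraph) (x y : G) s : is_path x s y -> is_path y (rev s) x.
Proof.
have revE : y :: rcons (rev s) x = rev (x :: rcons s y).
  by rewrite rev_cons rev_rcons.
rewrite /is_path revE rev_uniq => /andP[pa ->]; rewrite andbT.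
have := rev_path (@adj G) x (rcons s y); rewrite last_rcons belast_rcons rev_cons => ->.
by rewrite -(eq_path (fun u v => adj_sym u v)).
Qed.

Lemma subdivision_of_routing (H G : sgraph) (b : H -> G) k inn : injective b ->
  routing (fun p => b p.1) (fun p => b p.2) k (arcs H) (~: (b @: setT)) inn ->
  exists S : subdivision H G, spanning S /\ balanced S.
Proof.
move=> binj [pI sI fI cI uI].
pose inner u v := if (u, v) \in arcs H then inn (u, v) else rev (inn (v, u)).
have irev u v : adj u v -> inner v u = rev (inner u v).
  by move=> uv; rewrite /inner arcs_rev //; case: (_ \in _); rewrite /= ?revK.
have E u v : adj u v -> exists2 p, p \in arcs H &
    [set u; v] = [set p.1; p.2] /\ inner u v =i inn p /\ size (inner u v) = size (inn p).
  move=> uv; rewrite /inner.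
  have [uvA|vuA] := boolP ((u, v) \in arcs H); first by exists (u, v).
  exists (v, u); first by rewrite arcs_rev.
  by split; [rewrite setUC | split=> [x|]; rewrite ?mem_rev ?size_rev].
have ipath u v : adj u v -> is_path (b u) (inner u v) (b v).
  move=> uv; rewrite /inner.
  have [uvA|vuA] := boolP ((u, v) \in arcs H); first exact: pI uvA.
  by apply: is_path_rev; apply: (pI (v, u)); rewrite arcs_rev.
have nB w x : x \in ~: (b @: setT) -> b w != x.
  by rewrite inE; apply: contraNneq => <-; apply: imset_f.
have iB u v w : adj u v -> b w \notin inner u v.
  move=> /E[p pA [_ [-> _]]]; apply/negP => /(fI p _ pA)/(nB w).
  by rewrite eqxx.
have iD u v u' v' : adj u v -> adj u' v' -> [set u; v] != [set u'; v'] ->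
    forall x, ~~ ((x \in inner u v) && (x \in inner u' v')).
  move=> /E[p pA [-> [pE _]]] /E[p' pA' [-> [pE' _]]] ne x.
  apply: contraNN ne; rewrite pE pE' => /andP[xp xp'].
  by rewrite (uI p p' x).
exists (Subdivision binj ipath irev iB iD); split=> [x|u v u' v'] /=.
  have [/imsetP[w _ ->]|nx] := boolP (x \in b @: setT); first by left; exists w.
  right; have [|[u v] pA xp] := cI x; first by rewrite inE.
  exists u, v; rewrite /inner pA; split=> //.
  by move: pA; rewrite inE => /andP[].
move=> /E[p /sI/andP[_ sp] [_ [_ szp]]] /E[p' /sI/andP[sp' _] [_ [_ szp']]].
by rewrite /path_length szp szp' addn1 ltnS (leq_trans sp).
Qed.

Theorem corollary1p4 (R : realType) (eps : R) (eps_gt0 : 0 < eps) :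
  exists C0 : R, 0 < C0 /\
    forall H G : sgraph,
      (1 <= #|edges H|)%N ->
      no_isolated H ->
      C0 * #|edges H|%:R <= #|G|%:R ->
      (1 + eps) * #|G|%:R / 2 <= (min_degree G)%:R ->
      exists S : subdivision H G, spanning S /\ balanced S.
Proof.
(* K is the lower bound on k required by the routing. The term 3 accounts for
   the branch vertices and the rounding in k, and the last 8 / eps for the
   degrees lost to the branch vertices. *)
pose K := 8 / eps + 4 * 12 ^+ 4 / (eps / 64) ^+ 4.
have e4 : 0 < (eps / 64) ^+ 4 by rewrite exprn_gt0 // divr_gt0.
have a0 : 0 < 8 / eps by rewrite divr_gt0.
have b0 : 0 < 4 * 12 ^+ 4 / (eps / 64) ^+ 4 by rewrite divr_gt0 // mulr_gt0 // exprn_gt0.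
have K0 : 0 < K by rewrite addr_gt0.
exists (K + 3 + 8 / eps); split; first by rewrite !addr_gt0.
move=> H G h0 niH nC degG; set h := #|edges H| in h0 nC.
have mh : (#|H| <= 2 * h)%N := card_no_isolated niH.
have h0' : 0 < h%:R :> R by rewrite ltr0n.
have nC' : (K + 3) * h%:R <= #|G|%:R.
  by apply: le_trans nC; rewrite [leRHS]mulrDl lerDl mulr_ge0 // ltW.
have nE : 8 * h%:R <= eps * #|G|%:R.
  have : 8 / eps * h%:R <= #|G|%:R.
    by apply: le_trans nC; rewrite [leRHS]mulrDl lerDr mulr_ge0 // ltW // addr_gt0.
  by rewrite mulrAC ler_pdivrMr // [eps * _]mulrC.
have hn : (3 * h <= #|G|)%N.
  by rewrite -(ler_nat R) natrM; apply: le_trans nC'; rewrite ler_pM2r // lerDr ltW.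
have [b binj] : exists b : H -> G, injective b.
  apply: inj_of_card; apply: leq_trans mh (leq_trans _ hn).
  by rewrite leq_mul2r orbT.
pose F := ~: (b @: setT).
have cB : #|b @: setT| = #|H| by rewrite card_imset // cardsT.
have cF : #|F| = (#|G| - #|H|)%N by rewrite cardsCs setCK cB.
pose k := (#|F| %/ h)%N.
have kK : K <= k%:R.
  have : (#|G| < (k + 3) * h)%N.
    have := divn_eq #|F| h; have := ltn_pmod #|F| h0; rewrite -/k mulnDl cF.
    by move: mh hn; clear; lia.
  rewrite -(ltr_nat R) natrM natrD => /(le_lt_trans nC').
  by rewrite ltr_pM2r // ltrD2r => /ltW.
have k8 : 8 <= eps * k%:R.
  rewrite -ler_pdivrMl // mulrC; apply: le_trans kK.
  by rewrite lerDl ltW.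
have kbig : 4 * 12 ^+ 4 <= (eps / 64) ^+ 4 * k%:R.
  by rewrite -ler_pdivrMl // mulrC; apply: le_trans kK; rewrite lerDr ltW.
have [inn rI] : exists inn, routing (fun p => b p.1) (fun p => b p.2) k (arcs H) F inn.
  apply: (routing_exists eps_gt0 (j := (trunc_log 2 h).+1)) k8 kbig _.
  - rewrite card_arcs -/h; have /andP[lo hi] := trunc_log_bounds (isT : (1 < 2)%N) h0.
    by rewrite ltnW // expnS leq_mul2l.
  - split=> [|p _|p _|p]; first 1 last.
    + by rewrite in_setC negbK imset_f.
    + by rewrite in_setC negbK imset_f.
    + rewrite inE => /andP[pa _]; apply: contraTneq pa => /binj->.
      by rewrite adj_irrefl.
    rewrite card_arcs -/h /k; apply/andP; split; first exact: leq_trunc_div.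
    by rewrite ltnW // ltn_ceil.
  move=> v _.
  have dv : (degree v <= #|nbrs v :&: F| + 2 * h)%N.
    rewrite /degree -(cardsID F) leq_add2l; apply: leq_trans mh.
    by rewrite -cB subset_leq_card // setDE setCK subsetIr.
  have {dv} := leq_trans (min_degree_le v) dv.
  rewrite -(ler_nat R) natrD natrM => /(le_trans degG) dv.
  have FG : #|F|%:R <= #|G|%:R :> R by rewrite ler_nat max_card.
  have sl := slack_ub eps_gt0 (trunc_log 2 h).+1.
  apply: le_trans (_ : (1 / 2 + eps / 4) * #|G|%:R <= _).
    apply: ler_pM => //; last by rewrite lerD2l.
    rewrite addr_ge0 ?divr_ge0 //; apply: le_trans (slack_lb eps_gt0 _).
    by rewrite divr_ge0 // ltW.
  by move: dv nE; clear; lra.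
exact: subdivision_of_routing binj rI.
Qed.
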